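(* Let $G_1=(V_1,E_1)$ be a graph with $G_1=EI(\mathcal{H}_1)$ for some 3-uniform hypergraph $\mathcal{H}_1=(V_1,\mathcal{E}_1)$, let $v\in V_1$ with $d_{G_1}(v)\ge 2$, and let $T=(V_2,E_2)$ be a tree with $n\ge 2$ vertices such that $V_1\cap V_2=\{v\}$. Then the 1-fusion $G_1\oplus T=(V_1\cup V_2,\,E_1\cup E_2)$ is the edge intersection hypergraph of some 3-uniform hypergraph.
   Context: All graphs and hypergraphs are finite, may have isolated vertices, and have no loops or multiple edges. A hypergraph is 3-uniform if every hyperedge has exactly 3 vertices. The edge intersection hypergraph of $\mathcal{H}=(V,\mathcal{E})$ is $EI(\mathcal{H})=(V,\mathcal{E}^{EI})$ with $\mathcal{E}^{EI}=\{e_1\cap e_2 : e_1,e_2\in\mathcal{E},\ e_1\neq e_2,\ |e_1\cap e_2|\ge 2\}$; it has the same vertex set as $\mathcal{H}$, and when it is 2-uniform it is regarded as a simple graph; ''$G=EI(\mathcal{H})$'' means equality of vertex sets and edge sets. For two graphs sharing exactly one vertex, their 1-fusion $G_1\oplus T$ is simply their union (vertex sets and edge sets united). $d_{G_1}(v)$ denotes the degree of $v$ in $G_1$. *)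

(* Defs.v *)
From mathcomp Require Import all_boot.

Set Implicit Arguments.
Unset Strict Implicit.
Unset Printing Implicit Defensive.

(* Vertices are taken from an ambient finite type [T]; the vertex set is an
   explicit subset of [T], so that hypergraphs with different vertex sets can
   be compared and united.  Since [hedges] is a set of sets there are no
   multiple edges, and the bound [1 < #|e|] excludes loops (and empty edges).
   The well-formedness field is boolean, hence proof-irrelevant: Leibniz
   equality of hypergraphs is equality of vertex sets and of edge sets. *)
Record hypergraph (T : finType) := Hypergraph {
  verts : {set T};
  hedges : {set {set T}};
  hedgesP : [forall e in hedges, (e \subset verts) && (1 < #|e|)]
}.

Section Hypergraphs.

Variable T : finType.
Implicit Types (G H : hypergraph T) (v x y : T).

Definition uniform (k : nat) H : Prop := forall e, e \in hedges H -> #|e| = k.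

Definition is_graph G : Prop := uniform 2 G.

Definition EI_edges H : {set {set T}} :=
  [set e | [exists e1 in hedges H, exists e2 in hedges H,
              [&& e1 != e2, 1 < #|e1 :&: e2| & e == e1 :&: e2]]].

Fact EI_edgesP H :
  [forall e in EI_edges H, (e \subset verts H) && (1 < #|e|)].
Proof.
apply/forall_inP => e; rewrite inE => /exists_inP[e1 He1 /exists_inP[e2 _]].
case/and3P=> _ gt1 /eqP->; rewrite gt1 andbT.
have /andP[sub1 _] := forall_inP (hedgesP H) _ He1.
exact: subset_trans (subsetIl _ _) sub1.
Qed.

Definition EI H : hypergraph T := Hypergraph (EI_edgesP H).

Fact fusion_edgesP G1 G2 :
  [forall e in hedges G1 :|: hedges G2,
     (e \subset verts G1 :|: verts G2) && (1 < #|e|)].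
Proof.
apply/forall_inP => e; rewrite inE => /orP[] He.
  have /andP[sub ->] := forall_inP (hedgesP G1) _ He.
  by rewrite (subset_trans sub (subsetUl _ _)).
have /andP[sub ->] := forall_inP (hedgesP G2) _ He.
by rewrite (subset_trans sub (subsetUr _ _)).
Qed.

(* The 1-fusion of two graphs sharing exactly one vertex; that sharing
   condition is not part of the definition and has to be assumed in use. *)
Definition fusion G1 G2 : hypergraph T := Hypergraph (fusion_edgesP G1 G2).

Definition degree G v : nat := #|[set e in hedges G | v \in e]|.

(* In a graph this relation is irreflexive, because edges have two elements,
   and it only relates vertices of [G]. *)
Definition adj G : rel T := fun x y => [set x; y] \in hedges G.

Definition connected_graph G : Prop :=
  verts G != set0 /\
  forall x y, x \in verts G -> y \in verts G -> connect (adj G) x y.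

Definition acyclic_graph G : Prop :=
  forall c : seq T, 2 < size c -> ~ ucycle (adj G) c.

Definition is_tree G : Prop :=
  [/\ is_graph G, connected_graph G & acyclic_graph G].

End Hypergraphs.

(* Main.v *)
Require Import Defs.
From mathcomp Require Import all_boot.

(** The tree is glued on one vertex at a time.  A new leaf [x] is hung on [u]
    by adding two triples [{x,u,a}] and [{x,u,b}], which meet in [{x,u}]; no
    other new edge appears as soon as each of [{u,a}], [{u,b}] is an edge or
    lies in no hyperedge.  When [u] has two neighbours, these serve as [a] and
    [b].  Otherwise [u] is a recently added leaf, [a] is its only neighbour,
    and [b] is a vertex of [G1] sharing no hyperedge with [u]; such a vertex
    exists because the triples of a leaf only reach three other vertices,
    while [G1] has at least four. *)

Set Implicit Arguments.
Unset Strict Implicit.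
Unset Printing Implicit Defensive.

Section Gluing.

Variable T : finType.
Implicit Types (G H : hypergraph T) (S V : {set T}) (a b u v x y : T).

(** * Edges of intersection hypergraphs and two-element sets *)

Lemma hypergraph_eq G H :
  verts G = verts H -> hedges G = hedges H -> G = H.
Proof.
case: G H => [V E P] [V' E' P'] /= eqV eqE; subst V' E'.
by congr Hypergraph; apply: bool_irrelevance.
Qed.

Lemma hedge_sub H e : e \in hedges H -> e \subset verts H.
Proof. by case/(forall_inP (hedgesP H))/andP. Qed.

Lemma EI_edgesE H e :
  reflect (exists e1 e2, [/\ e1 \in hedges H, e2 \in hedges H, e1 != e2,
                             1 < #|e1 :&: e2| & e = e1 :&: e2])
          (e \in EI_edges H).
Proof.
rewrite inE; apply: (iffP exists_inP) => [[e1 He1]|[e1 [e2 [He1 He2 ne gt1 ->]]]].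
  by case/exists_inP=> e2 He2 /and3P[ne gt1 /eqP->]; exists e1, e2.
by exists e1 => //; apply/exists_inP; exists e2; rewrite // ne gt1 eqxx.
Qed.

Lemma EI_edge_gt1 H e : e \in EI_edges H -> 1 < #|e|.
Proof. by case/EI_edgesE=> e1 [e2 [_ _ _ gt1 ->]]. Qed.

Lemma EI_edge_sub H e : e \in EI_edges H -> e \subset verts H.
Proof. by case/(forall_inP (EI_edgesP H))/andP. Qed.

Lemma EI_pair_neq H u a : [set u; a] \in EI_edges H -> u != a.
Proof. by move/EI_edge_gt1; rewrite cards2; case: (u != a). Qed.

Lemma pair_set_eq (A : {set T}) u a :
  #|A| = 2 -> u \in A -> a \in A -> u != a -> A = [set u; a].
Proof.
move=> A2 uA aA ua; apply/esym/eqP; rewrite eqEcard cards2 ua A2 andbT.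
by rewrite subUset !sub1set uA.
Qed.

Lemma card2_other (A : {set T}) u :
  #|A| = 2 -> u \in A -> exists2 a, u != a & A = [set u; a].
Proof.
move=> A2 uA; have /card_gt0P[a] : 0 < #|A :\ u|.
  by move: (cardsD1 u A); rewrite A2 uA add1n => -[<-].
rewrite !inE => /andP[au aA]; exists a; first by rewrite eq_sym.
by apply: pair_set_eq; rewrite // eq_sym.
Qed.

(** * Hanging a single leaf *)

Definition cohabit H u b := [exists e in hedges H, (u \in e) && (b \in e)].

Lemma cohabitPn H u b e :
  ~~ cohabit H u b -> e \in hedges H -> u \in e -> b \in e -> False.
Proof.
by move=> nub He ue be; case/negP: nub; apply/exists_inP; exists e; rewrite ?ue.
Qed.

(** An old hyperedge can share two vertices with a triple made of [u], [b] and a fresh vertex only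
    by containing both [u] and [b]. Either disjunct makes this harmless. *)
Definition safe H u b := ([set u; b] \in EI_edges H) || ~~ cohabit H u b.

Section Pendant.

Variables (H : hypergraph T) (u x a b : T).
Hypotheses (H3 : uniform 3 H) (uV : u \in verts H) (xV : x \notin verts H).
Hypotheses (aV : a \in verts H) (bV : b \in verts H).
Hypotheses (ua : u != a) (ub : u != b) (ab : a != b).
Hypotheses (safe_a : safe H u a) (safe_b : safe H u b).

Let triple c := [set x; u; c].

Definition pendant_edges := triple a |: (triple b |: hedges H).

Fact pendant_edgesP :
  [forall e in pendant_edges, (e \subset x |: verts H) && (1 < #|e|)].
Proof.
have xu : x != u by apply: contraNneq xV => ->.
have tr c : c \in verts H -> (triple c \subset x |: verts H) && (1 < #|triple c|).
  move=> cV; rewrite !subUset !sub1set !inE eqxx uV cV !orbT /=.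
  apply: (@leq_trans #|[set x; u]|); first by rewrite cards2 xu.
  exact/subset_leq_card/subsetUl.
apply/forall_inP=> e; rewrite !inE => /or3P[/eqP->|/eqP->|He]; rewrite ?tr //.
have /andP[sub ->] := forall_inP (hedgesP H) _ He.
by rewrite (subset_trans sub (subsetUr _ _)).
Qed.

Definition pendant := Hypergraph pendant_edgesP.

Let neq_x c : c \in verts H -> x != c.
Proof. by move=> cV; apply: contraNneq xV => ->. Qed.

Lemma pendant_hedgesE e :
  (e \in hedges pendant) = [|| e == triple a, e == triple b | e \in hedges H].
Proof. by rewrite !in_setU1. Qed.

Lemma pendant_uniform : uniform 3 pendant.
Proof.
have tr c : c \in verts H -> u != c -> #|triple c| = 3.
  move=> cV uc; rewrite /triple setUC cardsU1 cards2 !inE neq_x //.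
  by rewrite ![c == _]eq_sym negb_or neq_x // uc.
by move=> e; rewrite pendant_hedgesE => /or3P[/eqP->|/eqP->|/H3//]; apply: tr.
Qed.

(** Since [e] misses the fresh [x], two common vertices must be exactly [u] and [c]. Then [e]
    contains both, and [safe] leaves only the case of an old edge. *)
Lemma triple_old c e :
    c \in verts H -> u != c -> safe H u c ->
    e \in hedges H -> 1 < #|triple c :&: e| ->
  triple c :&: e \in EI_edges H.
Proof.
move=> cV uc safe_c He gt1.
have xe : x \notin e by apply: contra xV; apply/subsetP/hedge_sub.
have sub : triple c :&: e \subset [set u; c].
  apply/subsetP=> z; rewrite !inE -orbA => /andP[/or3P[/eqP->|->|->] //].
    by rewrite (negPf xe).
  by rewrite orbT.
have eq2 : triple c :&: e = [set u; c].
  by apply/eqP; rewrite eqEcard sub cards2 uc.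
have /andP[ue ce] : (u \in e) && (c \in e).
  by rewrite -!sub1set -subUset -eq2 subsetIr.
by case/orP: safe_c => [|/cohabitPn]; [rewrite eq2 | case/(_ e He ue ce)].
Qed.

Lemma triple_meet : triple a :&: triple b = [set x; u].
Proof.
apply/setP=> z; rewrite !inE; case: (z == x) => //; case: (z == u) => //=.
by apply: contraNF ab => /andP[/eqP<- /eqP<-].
Qed.

Lemma pendant_EI : EI_edges pendant = [set x; u] |: EI_edges H.
Proof.
apply/setP=> e; rewrite in_setU1; apply/EI_edgesE/orP => [[e1 [e2 []]]|].
  rewrite !pendant_hedgesE => /or3P[/eqP->|/eqP->|He1] /or3P[/eqP->|/eqP->|He2] ne gt1 ->.
  - by rewrite eqxx in ne.
  - by left; rewrite triple_meet.
  - by right; apply: triple_old.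
  - by left; rewrite setIC triple_meet.
  - by rewrite eqxx in ne.
  - by right; apply: triple_old.
  - by right; rewrite setIC; apply: triple_old => //; rewrite setIC.
  - by right; rewrite setIC; apply: triple_old => //; rewrite setIC.
  by right; apply/EI_edgesE; exists e1, e2.
case=> [/eqP->|/EI_edgesE[e1 [e2 [He1 He2 ne gt1 ->]]]].
  exists (triple a), (triple b); rewrite triple_meet cards2 neq_x // !pendant_hedgesE !eqxx orbT.
  (* The vertex [a] tells the two triples apart. *)
  split=> //; apply/eqP=> /setP/(_ a); rewrite !inE eqxx orbT.
  by rewrite ![a == _]eq_sym (negPf (neq_x aV)) (negPf ua) eq_sym (negPf ab).
by exists e1, e2; rewrite !pendant_hedgesE He1 He2 !orbT.
Qed.

Lemma pendant_cohabit y z :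
  cohabit pendant y z ->
  cohabit H y z || (y \in triple a) && (z \in triple a)
                || (y \in triple b) && (z \in triple b).
Proof.
case/exists_inP=> e; rewrite in_setU1 => /predU1P[->|] => [->|]; first by rewrite orbT.
rewrite in_setU1 => /predU1P[-> ->|He yz]; first by rewrite !orbT.
suff -> : cohabit H y z by [].
by apply/exists_inP; exists e.
Qed.

End Pendant.

(* The second vertex [b] is drawn from a fixed set [V] so that hanging a leaf
   elsewhere does not spoil the non-cohabitation of [u] and [b]. *)
Definition extendable V H u :=
  exists a b, [/\ [set u; a] \in EI_edges H, u != b, a != b &
    ([set u; b] \in EI_edges H) || (b \in V) && ~~ cohabit H u b].

(** One step of the construction, with the invariant kept. The only old pairs that can start to
    share a hyperedge are [{u, a}], which is an edge, and [{u, b}]; the bound on [V :&: S] keeps the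
    latter from harming another vertex of [S]. *)
Lemma extendable_pendant V S H u x :
    uniform 3 H -> V \subset verts H -> 3 < #|V| -> u \in verts H ->
    x \notin verts H -> #|V :&: S| <= 1 -> u \in S -> S \subset verts H ->
    (forall y, y \in S -> extendable V H y) ->
  exists H', [/\ uniform 3 H', verts H' = x |: verts H,
    EI_edges H' = [set x; u] |: EI_edges H &
    forall y, y \in x |: S -> extendable V H' y].
Proof.
move=> H3 /subsetP VH V4 uV xV VS uS /subsetP SH extS.
have [a [b [Ea ub ab b_ok]]] := extS u uS.
have ua := EI_pair_neq Ea.
have aV : a \in verts H by apply: (subsetP (EI_edge_sub Ea)); rewrite set22.
have bV : b \in verts H.
  case/orP: b_ok => [Eb|/andP[/VH]//].
  by apply: (subsetP (EI_edge_sub Eb)); rewrite set22.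
have safe_a : safe H u a by rewrite /safe Ea.
have safe_b : safe H u b.
  by rewrite /safe; case/orP: b_ok => [->|/andP[_ ->]]; rewrite ?orbT.
have neq_x c : c \in verts H -> x != c by move=> cV; apply: contraNneq xV => ->.
have EI' := pendant_EI uV xV aV bV ua ub ab safe_a safe_b.
have EI_old e : e \in EI_edges H -> e \in EI_edges (pendant uV xV aV bV).
  by move=> He; rewrite EI' in_setU1 He orbT.
have EI_new : [set x; u] \in EI_edges (pendant uV xV aV bV).
  by rewrite EI' in_setU1 eqxx.
exists (pendant uV xV aV bV); split=> //; first exact: pendant_uniform.
move=> y; rewrite in_setU1 => /predU1P[{y}->|yS].
  (* The new leaf [x] lies only in the two new triples, so any [c] in [V] outside [u], [a], [b]
     shares no hyperedge with it. *)
  have /card_gt0P[c] : 0 < #|V :\: [set u; a; b]|.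
    rewrite cardsD subn_gt0; apply: leq_ltn_trans V4.
    apply: leq_trans (subset_leq_card (subsetIr _ _)) _.
    rewrite setUC cardsU1 cards2; by case: (_ \notin _); case: (_ != _).
  rewrite !inE !negb_or => /andP[/andP[/andP[cu ca] cb] cV].
  exists u, c; split; rewrite ?(neq_x c) ?VH // 1?eq_sym //.
  have cx : c == x = false by rewrite eq_sym (negPf (neq_x _ (VH _ cV))).
  rewrite cV /=; apply/orP; right; apply/negP=> /pendant_cohabit.
  rewrite !inE eqxx (negPf cu) (negPf ca) (negPf cb) cx /=.
  rewrite !orbF => /exists_inP[e He /andP[xe _]].
  by apply: (negP xV); apply: (subsetP (hedge_sub He)).
have [{y yS}->|yu] := eqVneq y u.
  (* Now [u] has the two neighbours [x] and [a]. *)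
  exists x, a; split=> //; first by rewrite setUC.
    exact: neq_x.
  by rewrite EI_old.
have [c [d [Ec yd cd d_ok]]] := extS y yS.
exists c, d; split=> //; first exact: EI_old.
case/orP: d_ok => [/EI_old->//|/andP[dV nyd]].
have [//|nE] := boolP (_ \in EI_edges _).
rewrite dV /=; apply/negP=> /pendant_cohabit.
have yx : y == x = false by rewrite eq_sym (negPf (neq_x _ (SH _ yS))).
have dx : d == x = false by rewrite eq_sym (negPf (neq_x _ (VH _ dV))).
rewrite (negPf nyd) !inE yx dx (negPf yu) /=.
(* As [y] is neither [x] nor [u], a new triple holding [y] and [d] has [y] as its third vertex, and
   then [d = u]. *)
have only_u f : (y == f) && ((d == u) || (d == f)) -> y = f /\ d = u.
  by case/andP=> /eqP<- /orP[/eqP-> //|/eqP dy]; case/eqP: yd.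
case/orP=> /only_u[ya du].
  by case/negP: nE; apply: EI_old; rewrite ya du setUC.
case/orP: b_ok => [Eb|/andP[bV' _]].
  by case/negP: nE; apply: EI_old; rewrite ya du setUC.
(* Both ends of the pair would lie in [V :&: S]. *)
have : [set y; d] \subset V :&: S.
  by rewrite subUset !sub1set !inE yS dV du uS ya bV'.
by move/subset_leq_card; rewrite cards2 yd => /leq_trans/(_ VS).
Qed.

(** * Growing a connected vertex set inside a tree *)

Lemma adj_sym G : symmetric (adj G).
Proof. by move=> y z; rewrite /adj setUC. Qed.

Definition adj_in G S : rel T := fun y z => [&& adj G y z, y \in S & z \in S].

Definition connected_in G S :=
  forall y z, y \in S -> z \in S -> connect (adj_in G S) y z.

(* A second neighbour of [x] in [S] would close a cycle through [x]. *)
Lemma acyclic_neighbor_uniq G S x y z :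
    acyclic_graph G -> connected_in G S -> x \notin S -> y \in S -> z \in S ->
    adj G x y -> adj G x z ->
  y = z.
Proof.
move=> acG connS xS yS zS xy xz; apply/eqP/negPn/negP => yz.
have /connectP[p0 p0P zE] := connS y z yS zS.
case/shortenP: p0P zE => p pP Up _ zE.
have pS : {subset p <= S}.
  elim: p y pP {yS xy yz Up zE} => //= w p IHp y /andP[/and3P[_ _ wS] /IHp sub].
  by move=> t; rewrite inE => /predU1P[->|/sub].
(* The path [p] is nonempty because [y] and [z] differ, so the cycle has at least three vertices. *)
apply: (acG (x :: y :: p)); first by case: p zE {pP Up pS} yz => //= ->; rewrite eqxx.
rewrite /ucycle [cycle _ _]/= rcons_path xy cons_uniq Up -zE adj_sym xz !andbT.
apply/andP; split.
  by apply: sub_path pP => s t /andP[].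
rewrite inE negb_or; apply/andP; split.
  by apply: contraNneq xS => ->.
by apply: contra xS => /pS.
Qed.

Lemma connected_in_add G S u x :
  connected_in G S -> u \in S -> adj G x u -> connected_in G (x |: S).
Proof.
move=> connS uS xu.
have sub : subrel (connect (adj_in G S)) (connect (adj_in G (x |: S))).
  apply: connect_sub => y z /and3P[yz yS zS]; apply: connect1.
  by rewrite /adj_in yz !inE yS zS !orbT.
have x_u : connect (adj_in G (x |: S)) x u.
  by apply: connect1; rewrite /adj_in xu !inE eqxx uS orbT.
have u_x : connect (adj_in G (x |: S)) u x.
  by apply: connect1; rewrite /adj_in adj_sym xu !inE eqxx uS orbT.
move=> y z; rewrite !in_setU1 => /predU1P[->|yS] /predU1P[->|zS] //.
- by apply: connect_trans x_u _; apply/sub/connS.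
- by apply: connect_trans u_x; apply/sub/connS.
exact/sub/connS.
Qed.

(** Follow a path from [v] to a vertex outside [S] and take the first step that leaves [S]. *)
Lemma connected_exit G S v :
    connected_graph G -> S \subset verts G -> v \in S -> S != verts G ->
  exists u x, [/\ u \in S, x \in verts G, x \notin S & adj G x u].
Proof.
move=> [_ connG] SG vS neS.
have /properP[_ [w wG wS]] : S \proper verts G by rewrite properEneq neS.
have /connectP[p pP wE] := connG v w (subsetP SG v vS) wG.
elim: p v vS pP wE => [|y p IHp] v vS /=; first by move=> _ eqw; rewrite eqw vS in wS.
case/andP=> vy pP wE; have [yS|yS] := boolP (y \in S); first exact: IHp yS pP wE.
exists v, y; split; rewrite 1?adj_sym //.
by apply: (subsetP (hedge_sub vy)); rewrite set22.
Qed.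

Definition induced_edges G S := [set e in hedges G | e \subset S].

(** A new induced edge contains [x]; its other end is a neighbour of [x] in [S], and acyclicity
    leaves only [u]. *)
Lemma induced_edges_add G S u x :
    is_graph G -> acyclic_graph G -> connected_in G S ->
    u \in S -> x \notin S -> adj G x u ->
  induced_edges G (x |: S) = [set x; u] |: induced_edges G S.
Proof.
move=> G_2 acG connS uS xS xu; apply/setP=> e; rewrite !inE.
have [->|ne] := eqVneq e [set x; u].
  by apply/andP; split; [exact: xu | rewrite subUset !sub1set !inE eqxx uS orbT].
apply: andb_id2l => He; apply/idP/idP => [sub|/subset_trans]; last by apply; apply: subsetUr.
have [xe|xe] := boolP (x \in e); last first.
  apply/subsetP=> z ze; have /setU1P[zx|//] := subsetP sub z ze.
  by rewrite -zx ze in xe.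
have [y xy eE] := card2_other (G_2 e He) xe.
have yS : y \in S.
  have : y \in x |: S by apply: (subsetP sub); rewrite eE set22.
  by rewrite in_setU1 eq_sym (negPf xy).
case/eqP: ne; rewrite eE; congr [set _; _].
by apply: (@acyclic_neighbor_uniq G S x) => //; rewrite /adj -eE.
Qed.

(** Here [S] is the connected part of the tree already attached, and the induction is on the number
    of tree vertices still outside it. *)
Lemma glue_tree G E V H S v :
    is_tree G -> 3 < #|V| -> V :&: verts G \subset S -> #|V :&: verts G| <= 1 ->
    v \in S -> S \subset verts G -> connected_in G S ->
    uniform 3 H -> verts H = V :|: S -> EI_edges H = E :|: induced_edges G S ->
    (forall y, y \in S -> extendable V H y) ->
  exists H', [/\ uniform 3 H', verts H' = V :|: verts G &
                 EI_edges H' = E :|: hedges G].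
Proof.
move=> [G_2 connG acG] V4 VGS VG1.
have [n] := ubnP #|verts G :\: S|; elim: n S H VGS => // n IHn S H VGS.
rewrite ltnS => len vS SG connS H3 HV HE extS.
have [SE|neS] := eqVneq S (verts G).
  exists H; split; rewrite ?HV ?HE ?SE //; congr (_ :|: _).
  apply/setP=> e; rewrite inE; apply: andb_idr; exact: hedge_sub.
have [u [x [uS xG xS xu]]] := connected_exit connG SG vS neS.
have xV : x \notin V.
  by apply: contra xS => xV; apply: (subsetP VGS); rewrite inE xV.
have [|||||H' [H'3 H'V H'E extS']] := @extendable_pendant V S H u x H3 _ V4 _ _ _ uS _ extS.
- by rewrite HV subsetUl.
- by rewrite HV inE uS orbT.
- by rewrite HV inE negb_or xV.
- by apply: leq_trans VG1; apply/subset_leq_card/setIS.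
- by rewrite HV subsetUr.
apply: (IHn (x |: S) H') => //.
- exact: subset_trans VGS (subsetUr _ _).
- apply: leq_trans len; apply: proper_card; apply/properP; split.
    by apply: setDS; apply: subsetUr.
  by exists x; rewrite !inE ?xG ?xS // eqxx.
- by rewrite inE vS orbT.
- by rewrite subUset sub1set xG.
- exact: connected_in_add xu.
- by rewrite H'V HV setUCA.
- by rewrite H'E HE (@induced_edges_add G S u x) // setUCA.
Qed.

(** Two triples meeting in two vertices span 3 + 3 - 2 = 4 vertices. *)
Lemma uniform3_EI_card H e :
  uniform 3 H -> uniform 2 (EI H) -> e \in EI_edges H -> 3 < #|verts H|.
Proof.
move=> H3 H2 He; have e2 := H2 e He.
have [f [g [Hf Hg _ _ eE]]] := EI_edgesE _ _ He.
have <- : #|f :|: g| = 4 by rewrite cardsU H3 // H3 // -eE e2.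
by apply: subset_leq_card; rewrite subUset !hedge_sub.
Qed.

End Gluing.

Theorem theorem4 (T : finType) (G1 H1 G2 : hypergraph T) (v : T)
    (G1_graph : is_graph G1)
    (H1_uniform : uniform 3 H1)
    (H1_verts : verts H1 = verts G1)
    (G1_EI : G1 = EI H1)
    (v_in : v \in verts G1)
    (deg_v : 2 <= degree G1 v)
    (G2_tree : is_tree G2)
    (G2_size : 2 <= #|verts G2|)
    (share_v : verts G1 :&: verts G2 = [set v]) :
  exists H : hypergraph T, uniform 3 H /\ fusion G1 G2 = EI H.
Proof.
have hG1 : hedges G1 = EI_edges H1 by rewrite G1_EI.
have /card_gt1P[e [f [+ + ef]]] := deg_v.
rewrite !inE => /andP[He ve] /andP[Hf vf].
have [a va eE] := card2_other (G1_graph e He) ve.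
have [b vb fE] := card2_other (G1_graph f Hf) vf.
rewrite hG1 in He Hf; rewrite eE fE in He Hf ef.
have vG2 : v \in verts G2.
  by have : v \in [set v] := set11 v; rewrite -share_v inE => /andP[].
have V4 : 3 < #|verts G1|.
  by rewrite -H1_verts; apply: uniform3_EI_card He; rewrite // -G1_EI.
(* Gluing starts at [S = {v}], which induces no tree edge. *)
have [|||||||||H [H3 HV HE]] :=
    @glue_tree T G2 (hedges G1) (verts G1) H1 [set v] v G2_tree V4.
- by rewrite share_v.
- by rewrite share_v cards1.
- exact: set11.
- by rewrite sub1set.
- by move=> y z /set1P-> /set1P->.
- exact: H1_uniform.
- by rewrite H1_verts; apply/esym/setUidPl; rewrite sub1set.
- rewrite hG1; apply/esym/setUidPl/subsetP=> g; rewrite inE => /andP[Hg].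
  by move/subset_leq_card; rewrite cards1; case: G2_tree => /(_ g Hg) ->.
(* The degree bound supplies two neighbours of [v], distinct because the edges [e] and [f] are. *)
- move=> y /set1P->; exists a, b; rewrite He Hf; split=> //.
  by apply: contraNneq ef => ->.
by exists H; split=> //; apply: hypergraph_eq; rewrite /= ?HV ?HE.
Qed.
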